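(* Let $\{x_n\}_{n\in\mathbb{N}}$ be a multiplicatively admissible sequence in $\mathbb{R}_+$ and let $f:\mathbb{R}_+\to\mathbb{R}_+$ be Baire. Suppose that $$a_n f(\lambda x_n)\to g(\lambda)\qquad (n\to\infty)\qquad\text{for each }\lambda\in B,$$ for some non-meagre Baire set $B\subseteq(0,\infty)$, some positive sequence $\{a_n\}_{n\in\mathbb{N}}$ and some function $g:B\to\mathbb{R}_+$. Then $f$ is strongly quasi regularly varying: for each $s>0$, $$K(s):=\mathrm{ess}\text{-}\lim_{\lambda\to\infty} f(s\lambda)/f(\lambda)$$ exists and is finite, and $K$ is multiplicative, i.e. $K(st)=K(s)K(t)$ for all $s,t>0$. Moreover $K$ is locally bounded near $s=1$, and so there is $\kappa\in\mathbb{R}$ with $K(s)=s^{\kappa}$ for all $s>0$.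
   Context: $\mathbb{R}_+:=(0,\infty)$. A set or function is Baire if it has the Baire property (a function is Baire if preimages of open sets have the Baire property). A sequence $\{c_n\}$ of positive reals with $\limsup_{n\to\infty}c_n=\infty$ is multiplicatively admissible if $\limsup_{n\to\infty}c_{n+1}/c_n=1$. Essential limit: for a real-valued function $f$ and a real number $L$, write $\mathrm{ess}\text{-}\lim_{x\to\infty}f(x)=L$ if for each $\varepsilon>0$ there are $X_\varepsilon\in\mathbb{R}$ and a meagre set $M_\varepsilon$ such that $|f(x)-L|<\varepsilon$ for all $x>X_\varepsilon$ with $x\notin M_\varepsilon$. A Baire function $f:\mathbb{R}_+\to\mathbb{R}_+$ is weakly quasi regularly varying if $k(t):=\mathrm{ess}\text{-}\lim_{x\to\infty}f(tx)/f(x)$ exists and is finite for each $t>0$; it is strongly quasi regularly varying if in addition the function $k$ is Baire. *)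

(* Defs.v *)
From mathcomp Require Import all_boot all_order all_algebra.
From mathcomp Require Import all_classical all_reals all_analysis.

Set Implicit Arguments.
Unset Strict Implicit.
Unset Printing Implicit Defensive.

Import Order.TTheory GRing.Theory Num.Theory.
Import numFieldNormedType.Exports.

Local Open Scope classical_set_scope.
Local Open Scope ring_scope.

Definition nowhere_dense (T : topologicalType) (A : set T) : Prop :=
  interior (closure A) = set0.

Definition meagre (T : topologicalType) (A : set T) : Prop :=
  exists F : nat -> set T,
    (forall n, nowhere_dense (F n)) /\ A = \bigcup_n F n.

Definition baire_set (T : topologicalType) (A : set T) : Prop :=
  exists U : set T, open U /\ meagre ((A `\` U) `|` (U `\` A)).

(* A function on (0, oo) is represented by a total function R -> R whose
   values outside (0, oo) are irrelevant.  As (0, oo) is open in R, a subset of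
   (0, oo) is meagre (resp. has the Baire property) in (0, oo) iff it does
   in R. *)
Definition baire_fun_pos (R : realType) (f : R -> R) : Prop :=
  forall V : set R, open V -> baire_set (`]0, +oo[ `&` f @^-1` V).

Definition multiplicatively_admissible (R : realType) (c : nat -> R) : Prop :=
  [/\ forall n, 0 < c n,
      limn_esup (fun n => (c n)%:E) = +oo%E
    & limn_esup (fun n => (c n.+1 / c n)%:E) = 1%E].

Definition is_ess_lim_pinfty (R : realType) (f : R -> R) (L : R) : Prop :=
  forall eps : R, 0 < eps ->
    exists (X : R) (M : set R), meagre M /\
      forall x, X < x -> ~ M x -> `|f x - L| < eps.

Definition is_ess_ratio_lim (R : realType) (f k : R -> R) : Prop :=
  forall t : R, 0 < t -> is_ess_lim_pinfty (fun x => f (t * x) / f x) (k t).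

(* The essential limit is unique, so [k] is determined on (0, oo) by [f]. *)
Definition strongly_quasi_regularly_varying (R : realType) (f : R -> R) : Prop :=
  [/\ forall x, 0 < x -> 0 < f x, baire_fun_pos f
    & exists k : R -> R, is_ess_ratio_lim f k /\ baire_fun_pos k].

(* Main.v *)
(* If u and s u both lie in B, then f(s u x_n) / f(u x_n) converges.  By the Baire
   category theorem this convergence is uniform up to a given error, and the
   limits agree up to that error, on a comeagre part of some interval ]p, q[.
   Since limsup x_{n+1} / x_n = 1 and x_n is unbounded, the intervals x_n ]p, q[
   cover a neighbourhood of +oo, so f(s y) / f(y) satisfies the Cauchy criterion
   along the filter of essential neighbourhoods of +oo.  For s near 1 there are
   enough such u, because B is comeagre in an interval; multiplicativity of the
   limit then gives every s > 0.  Applied to a_n f(u x_n) itself, the same category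
   argument bounds K near 1, so t |-> ln (K (e^t)) is additive and bounded above
   near 0, hence linear. *)
Require Import Defs.
From mathcomp Require Import all_boot all_order all_algebra.
From mathcomp Require Import all_classical all_reals all_analysis.
From mathcomp Require Import lra ring.
Import Order.TTheory GRing.Theory Num.Theory.
Import numFieldNormedType.Exports.
Local Open Scope classical_set_scope.
Local Open Scope ring_scope.

Set Implicit Arguments.
Unset Strict Implicit.
Unset Printing Implicit Defensive.

(** * Meagre sets and the Baire property in a topological space *)

Section Meagre.
Context {T : topologicalType}.
Implicit Types A B C : set T.

Lemma nowhere_dense_sub A B : A `<=` B -> nowhere_dense B -> nowhere_dense A.
Proof.
move=> AB B0; apply/seteqP; split => // y Ay; rewrite -B0.
by apply: interiorS Ay; exact: closureS.
Qed.

Lemma nowhere_dense0 : @nowhere_dense T set0.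
Proof. by rewrite /nowhere_dense closure0 interior0. Qed.

Lemma meagre_sub A B : A `<=` B -> meagre B -> meagre A.
Proof.
move=> AB [F [ndF BE]]; exists (fun n => F n `&` A); split.
  by move=> n; apply: nowhere_dense_sub (ndF n) => y [].
by rewrite -setI_bigcupl -BE; apply/esym/setIidPr.
Qed.

Lemma nowhere_dense_meagre A : nowhere_dense A -> meagre A.
Proof. by move=> ndA; exists (fun=> A); split => //; rewrite bigcup_const. Qed.

Lemma meagre0 : meagre (@set0 T).
Proof. exact/nowhere_dense_meagre/nowhere_dense0. Qed.

Lemma meagre_bigcup (I : countType) (A : I -> set T) :
  (forall i, meagre (A i)) -> meagre (\bigcup_i A i).
Proof.
move=> /choice[F AF].
(* The doubly indexed family [F i k] is listed along [nat] by [pickle]; numbers that code no pair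
   get the empty set. *)
pose G n : set T := if unpickle n is Some p then F p.1 p.2 else set0.
have : meagre (\bigcup_n G n).
  exists G; split => // n; rewrite /G.
  case: unpickle => [[i k]|]; last exact: nowhere_dense0.
  by have [] := AF i.
apply: meagre_sub => y [i _]; have [_ ->] := AF i => -[k _ Fy].
by exists (pickle (i, k)) => //; rewrite /G pickleK.
Qed.

Lemma meagreU A B : meagre A -> meagre B -> meagre (A `|` B).
Proof.
move=> mA mB; apply: (@meagre_sub _ (\bigcup_b if b then A else B)).
  by move=> y [Ay|By]; [exists true|exists false].
by apply: meagre_bigcup => -[].
Qed.

Lemma closed_boundary_meagre A : closed A -> meagre (A `\` A°).
Proof.
move=> cA; apply: nowhere_dense_meagre; apply/seteqP; split => // y.
rewrite /nowhere_dense -(closure_id _).1; last first.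
  by apply: closedI => //; exact/open_closedC/open_interior.
rewrite setDE interiorI => -[Ay /interior_subset]; exact.
Qed.

Lemma open_baire A : open A -> baire_set A.
Proof. by move=> oA; exists A; rewrite setDv setU0; split => //; exact: meagre0. Qed.

Lemma baire_setC A : baire_set A -> baire_set (~` A).
Proof.
move=> [U [oU mAU]]; exists (~` U)°; split; first exact: open_interior.
have := meagreU mAU (closed_boundary_meagre (open_closedC oU)).
apply: meagre_sub => y [[nAy nU]|[/interior_subset nUy nAy]]; last first.
  by left; left; split => //; exact: contrapT.
by have [Uy|nUy] := pselect (U y); [left; right|right].
Qed.

Lemma baire_bigcup (I : countType) (A : I -> set T) :
  (forall i, baire_set (A i)) -> baire_set (\bigcup_i A i).
Proof.
move=> /choice[U AU]; exists (\bigcup_i U i); split.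
  by apply: bigcup_open => i _; have [] := AU i.
have : meagre (\bigcup_i ((A i `\` U i) `|` (U i `\` A i))).
  by apply: meagre_bigcup => i; have [] := AU i.
apply: meagre_sub => y [[[i _ Ay] nU]|[[i _ Uy] nA]].
  by exists i => //; left; split => // Uiy; apply: nU; exists i.
by exists i => //; right; split => // Aiy; apply: nA; exists i.
Qed.

Lemma baire_bigcap (I : countType) (A : I -> set T) :
  (forall i, baire_set (A i)) -> baire_set (\bigcap_i A i).
Proof.
move=> bA; rewrite -[X in baire_set X]setCK setC_bigcap.
by apply/baire_setC/baire_bigcup => i; exact/baire_setC.
Qed.

Lemma baire_setI A B : baire_set A -> baire_set B -> baire_set (A `&` B).
Proof.
move=> bA bB; rewrite (_ : A `&` B = \bigcap_b if b then A else B).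
  by apply: baire_bigcap => -[].
apply/seteqP; split => [y [Ay By] [] //|y H].
by split; [exact: (H true)|exact: (H false)].
Qed.

Lemma baire_nonmeagre_open A : baire_set A -> ~ meagre A ->
  exists U, [/\ open U, U `&` A !=set0 & meagre (U `\` A)].
Proof.
move=> [U [oU mAU]] nmA; exists U; split => //; last first.
  by apply: meagre_sub mAU => y; right.
apply/set0P/negP => /eqP UA0; apply: nmA; apply: meagre_sub mAU => y Ay.
left; split => // Uy; have : (U `&` A) y by [].
by rewrite UA0.
Qed.

Lemma nonmeagre_bigcup (I : countType) (E : I -> set T) A :
  ~ meagre A -> A `<=` \bigcup_i E i -> exists i, ~ meagre (E i).
Proof.
move=> nmA AE; apply/existsNP => mE; apply: nmA.
by apply: meagre_sub AE _; exact: meagre_bigcup.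
Qed.

Lemma meagre_preimage (h k : T -> T) A : continuous h -> continuous k ->
  cancel h k -> cancel k h -> meagre A -> meagre (h @^-1` A).
Proof.
move=> ch ck hK kH [F [ndF ->]]; exists (fun n => h @^-1` F n); split; last first.
  by rewrite preimage_bigcup.
move=> n; apply/seteqP; split => // y Hy.
suff : (closure (F n))° (h y) by rewrite ndF.
set W := (closure (h @^-1` F n))° in Hy.
have oW : open (k @^-1` W).
  by apply: open_comp => [z _|]; [exact: ck|exact: open_interior].
have : k @^-1` W `<=` closure (F n).
  move=> z /interior_subset Wz B Bz.
  have : nbhs (k z) (h @^-1` B) by apply: ch; rewrite kH.
  by move=> /Wz[t [Ft Bt]]; exists (h t).
rewrite (open_subsetE _ oW); apply.
by rewrite /preimage /= hK.
Qed.

Lemma baire_preimage (h k : T -> T) A : continuous h -> continuous k ->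
  cancel h k -> cancel k h -> baire_set A -> baire_set (h @^-1` A).
Proof.
move=> ch ck hK kH [U [oU mAU]]; exists (h @^-1` U); split.
  by apply: open_comp => // z _; exact: ch.
exact: meagre_preimage ch ck hK kH mAU.
Qed.

End Meagre.

(** * Category on the real line and Baire functions on (0, oo) *)

Section BaireReal.
Context {R : realType}.
Implicit Types (A B M V : set R) (f : R -> R) (c p q t : R).

(** By the Baire category theorem the complements of the [closure (F n)], open and dense, have a
    dense intersection, which would meet [A]. *)
Lemma open_nonmeagre A : open A -> A !=set0 -> ~ meagre A.
Proof.
move=> oA A0 [F [ndF AF]].
have : dense (\bigcap_n ~` closure (F n)).
  apply: Baire => n; split; first exact/closed_openC/closed_closure.
  move=> D [y Dy] oD; apply: contrapT => DF.
  suff : (closure (F n))° y by rewrite ndF.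
  have DF' : D `<=` closure (F n).
    by move=> z Dz; apply: contrapT => Fz; apply: DF; exists z.
  by rewrite (open_subsetE _ oD) in DF'; exact: DF'.
move=> /(_ A A0 oA)[y []]; rewrite {1}AF => -[n _ Fy] /(_ n I); apply.
exact: subset_closure.
Qed.

Lemma itv_nonmeagre p q : p < q -> ~ meagre `]p, q[.
Proof.
move=> pq; apply: open_nonmeagre; first exact: interval_open.
by exists ((p + q) / 2); rewrite /= in_itv/=; apply/andP; split; lra.
Qed.

Lemma baire_nonmeagre_itv A : A `<=` `]0, +oo[ -> baire_set A -> ~ meagre A ->
  exists p q, [/\ 0 < p, p < q & meagre (`]p, q[ `\` A)].
Proof.
move=> A0 bA /(baire_nonmeagre_open bA)[U [oU [y [Uy Ay]] mUA]].
have /= := A0 _ Ay; rewrite in_itv/= andbT => y0.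
have /nbhs_ballP[e /= e0 yU] := open_nbhs_nbhs (conj oU Uy).
(* The cap [y / 2] keeps the left endpoint [y - d] positive. *)
pose d := Num.min e (y / 2).
have d0 : 0 < d by rewrite lt_min e0 divr_gt0.
have dy : d <= y / 2 by rewrite ge_min lexx orbT.
have de : d <= e by rewrite ge_min lexx.
exists (y - d), (y + d); split; [lra|lra|].
apply: meagre_sub mUA => z [/= zyd nAz]; split => //; apply: yU.
rewrite /ball/= ltr_distlC; move: zyd; rewrite in_itv/= => /andP[z1 z2].
by apply/andP; split; lra.
Qed.

Lemma meagre_scale t M : 0 < t -> meagre M -> meagre (( *%R t) @^-1` M).
Proof.
move=> t0; apply: (@meagre_preimage _ _ ( *%R t^-1)).
- exact: mulrl_continuous.
- exact: mulrl_continuous.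
- by move=> y; rewrite mulKf ?gt_eqF.
- by move=> y; rewrite mulVKf ?gt_eqF.
Qed.

Lemma baire_scale t A : 0 < t -> baire_set A -> baire_set (( *%R t) @^-1` A).
Proof.
move=> t0; apply: (@baire_preimage _ _ ( *%R t^-1)).
- exact: mulrl_continuous.
- exact: mulrl_continuous.
- by move=> y; rewrite mulKf ?gt_eqF.
- by move=> y; rewrite mulVKf ?gt_eqF.
Qed.

Lemma baire_fun_pos_cst c : baire_fun_pos (fun=> c : R).
Proof.
move=> V oV; apply: open_baire.
have [Vc|nVc] := pselect (V c).
  rewrite (_ : _ @^-1` _ = setT) ?setIT; first exact: interval_open.
  by apply/seteqP; split => // y _.
rewrite (_ : _ @^-1` _ = set0) ?setI0; first exact: open0.
by apply/seteqP; split.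
Qed.

Lemma baire_fun_pos_scale c t f : 0 < t -> baire_fun_pos f ->
  baire_fun_pos (fun u => c * f (u * t)).
Proof.
move=> t0 bf V oV.
have oV' : open (( *%R c) @^-1` V).
  by apply: open_comp => // y _; exact: mulrl_continuous.
rewrite (_ : _ `&` _ =
    ( *%R t) @^-1` (`]0, +oo[ `&` f @^-1` (( *%R c) @^-1` V))).
  exact/baire_scale/bf.
by apply/seteqP; split=> y [] /=; rewrite !in_itv/= !andbT (mulrC y) pmulr_rgt0.
Qed.

(** The inequality fails exactly when some rational separates the two values, so the complement in
    (0, oo) is a countable union of sets with the Baire property. *)
Lemma baire_le f1 f2 : baire_fun_pos f1 -> baire_fun_pos f2 ->
  baire_set (`]0, +oo[ `&` [set u | f1 u <= f2 u]).
Proof.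
move=> b1 b2.
have bq : baire_set (\bigcup_(q : rat) ((`]0, +oo[ `&` f1 @^-1` `]ratr q, +oo[) `&`
    (`]0, +oo[ `&` f2 @^-1` `]-oo, ratr q[))).
  by apply: baire_bigcup => q; apply: baire_setI;
    [apply: b1|apply: b2]; exact: interval_open.
rewrite (_ : _ `&` _ = `]0, +oo[ `&` ~` (\bigcup_(q : rat)
    ((`]0, +oo[ `&` f1 @^-1` `]ratr q, +oo[) `&`
    (`]0, +oo[ `&` f2 @^-1` `]-oo, ratr q[)))).
  by apply: baire_setI (baire_setC bq); exact/open_baire/interval_open.
apply/seteqP; split => y [y0 /= H]; split => //.
  move=> [q _ [[_ /=]]]; rewrite in_itv/= andbT => qf1 [_ /=].
  by rewrite in_itv/= ltNge (le_trans (ltW qf1)).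
rewrite leNgt; apply/negP => /rat_in_itvoo[q]; rewrite in_itv/= => /andP[q1 q2].
by apply: H; exists q => //; split; split => //=; rewrite in_itv/= ?andbT.
Qed.

End BaireReal.

(** * The filter of essential neighbourhoods of +oo, and admissible sequences *)

Section EssentialFilter.
Context {R : realType}.
Implicit Types (P : set R) (phi : R -> R) (t p q : R).

(** Stating essential limits as limits along a filter gives access to the general results on
    products, uniqueness and the Cauchy criterion. *)
Definition ess_pinfty : set_system R :=
  [set P | exists X M, meagre M /\ forall y, X < y -> ~ M y -> P y].

Global Instance ess_pinfty_proper : ProperFilter ess_pinfty.
Proof.
split.
  (* Properness is the category theorem again: the meagre exceptional set cannot contain []X, X +
     1[]. *)
  move=> [X [M [mM H]]]; have : X < X + 1 by rewrite ltrDl.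
  move=> /itv_nonmeagre; apply; apply: meagre_sub mM => y /=.
  by rewrite in_itv/= => /andP[Xy _]; apply: contrapT => /(H _ Xy).
split.
- by exists 0, set0; split => //; exact: meagre0.
- move=> P Q [X [M [mM HP]]] [Y [N [mN HQ]]].
  exists (Num.max X Y), (M `|` N); split; first exact: meagreU.
  by move=> y; rewrite gt_max => /andP[Xy Yy] /not_orP[nM nN]; split; auto.
- move=> P Q PQ [X [M [mM H]]]; exists X, M; split => // y Xy nMy.
  exact/PQ/H.
Qed.

Lemma ess_pinfty_gt t : \forall y \near ess_pinfty, t < y.
Proof. by exists t, set0; split => //; exact: meagre0. Qed.

Lemma is_ess_limP phi L :
  is_ess_lim_pinfty phi L <-> phi y @[y --> ess_pinfty] --> L.
Proof.
rewrite cvgrPdist_lt; split => H e /H [X [M [mM XM]]];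
  by exists X, M; split => // y Xy /(XM _ Xy); rewrite distrC.
Qed.

Lemma ess_pinfty_scale t : 0 < t -> t * y @[y --> ess_pinfty] --> ess_pinfty.
Proof.
move=> t0 P [X [M [mM H]]]; exists (X / t), (( *%R t) @^-1` M).
split; first exact: meagre_scale.
by move=> y; rewrite ltr_pdivrMr// mulrC => /H.
Qed.

(** The limsup is an infimum of suprema over eventual sets, so an infinite limsup makes the supremum
    over every tail infinite. *)
Lemma admissible_unbounded (x : nat -> R) : multiplicatively_admissible x ->
  forall N t, exists2 n, (N <= n)%N & t < x n.
Proof.
move=> [_ xoo _] N t.
have : (t%:E < ereal_sup [set (x n)%:E | n in [set n | (N <= n)%N]])%E.
  apply: (@lt_le_trans _ _ +oo%E); first exact: ltry.
  rewrite -xoo; apply: ereal_inf_lbound => /=.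
  by exists [set n | (N <= n)%N] => //; exists N.
by move=> /ereal_sup_gt[_ /= [n Nn <-]]; rewrite lte_fin; exists n.
Qed.

Lemma admissible_ratio (x : nat -> R) : multiplicatively_admissible x ->
  forall r, 1 < r -> \forall n \near \oo, x n.+1 < r * x n.
Proof.
move=> [x0 _ x1] r r1.
have : (limn_esup (fun n => (x n.+1 / x n)%:E) < r%:E)%E by rewrite x1 lte_fin.
move=> /ereal_inf_lt[_ /= [V nV <-] Vr].
apply: filterS nV => n Vn; rewrite -ltr_pdivrMr// -lte_fin.
by apply: le_lt_trans Vr; apply: ereal_sup_ubound; exists n.
Qed.

(** Take the least [m >= n0] with [y < q * x m]. As [y] exceeds [q * x n0], [m] has a predecessor
    beyond [n0], or equal to it, where [q * x m.-1 <= y]; the ratio bound [q / p] then gives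
    [p * x m < q * x m.-1]. *)
Lemma admissible_cover (x : nat -> R) p q N : multiplicatively_admissible x ->
  0 < p -> p < q -> exists X, forall y, X < y ->
    exists n, [/\ (N <= n)%N, p * x n < y & y < q * x n].
Proof.
move=> x_adm p0 pq; have q0 := lt_trans p0 pq.
have /(admissible_ratio x_adm)[n1 _ Hn1] : 1 < q / p by rewrite ltr_pdivlMr// mul1r.
pose n0 := maxn N n1.
exists (q * x n0) => y Xy.
have exP : exists m, (n0 <= m)%N && (y < q * x m).
  have [m n0m xm] := admissible_unbounded x_adm n0 (y / q).
  by exists m; rewrite n0m mulrC -ltr_pdivrMr.
case: (ex_minnP exP) => m /andP[n0m ym] mmin.
exists m; split => //; first exact: leq_trans (leq_maxl _ _) n0m.
have n0m' : (n0 < m)%N.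
  rewrite ltn_neqAle n0m andbT; apply/eqP => n0E.
  by rewrite -n0E ltNge (ltW Xy) in ym.
case: m => // m in n0m ym mmin n0m' *.
have qxm : q * x m <= y.
  rewrite leNgt; apply/negP => yqx.
  by have := mmin m; rewrite yqx andbT ltnn => /(_ n0m').
apply: lt_le_trans qxm; rewrite mulrC -ltr_pdivlMr// mulrAC; apply: Hn1 => /=.
exact: leq_trans (leq_maxr _ _) n0m'.
Qed.

(* Every large y lies in x_n ]p, q[ for some n >= N, and the union over n of the
   sets x_n (]p, q[ \ A) is meagre. *)
Lemma ess_pinfty_cover (x : nat -> R) p q N (A P : set R) :
  multiplicatively_admissible x -> 0 < p -> p < q -> meagre (`]p, q[ `\` A) ->
  (forall u n, A u -> (N <= n)%N -> P (u * x n)) ->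
  \forall y \near ess_pinfty, P y.
Proof.
move=> x_adm p0 pq mA AP; have [x0 _ _] := x_adm.
have [X HX] := admissible_cover N x_adm p0 pq.
exists X, (\bigcup_n ( *%R (x n)^-1) @^-1` (`]p, q[ `\` A)); split.
  by apply: meagre_bigcup => n; apply: meagre_scale; rewrite // invr_gt0.
move=> y /HX[n [Nn pxy yxq]] nM.
rewrite -(mulVKf (lt0r_neq0 (x0 n)) y) mulrC; apply: AP => //.
apply: contrapT => nA; apply: nM; exists n => //; split => //=.
by rewrite in_itv/= mulrC ltr_pdivlMr// ltr_pdivrMr// pxy.
Qed.

End EssentialFilter.

(** * Additive and multiplicative functions bounded above locally *)

Section Additive.
Context {R : realType}.
Implicit Types (phi K : R -> R) (s t r : R).

(** Subtracting the linear function that agrees with [phi] at [tau] leaves an additive [psi]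
    vanishing at [tau]. A global upper bound for [psi] forces [psi <= 0], and oddness then forces
    [psi = 0]. *)
Lemma additive_bounded_above_linear phi C r : 0 < r ->
  (forall s t, phi (s + t) = phi s + phi t) ->
  (forall t, `|t| < r -> phi t <= C) -> exists c, forall t, phi t = c * t.
Proof.
move=> r0 phiD phiC.
have phi0 : phi 0 = 0 by apply: (addIr (phi 0)); rewrite -phiD !add0r.
pose tau := r / 2; have tau0 : 0 < tau by rewrite divr_gt0.
pose c := phi tau / tau; exists c.
pose psi t := phi t - c * t.
have psiD s t : psi (s + t) = psi s + psi t by rewrite /psi phiD; ring.
have psi0 : psi 0 = 0 by rewrite /psi phi0 mulr0 subrr.
have psiN t : psi (- t) = - psi t.
  by apply: (addIr (psi t)); rewrite -psiD !addNr.
have psiMn n t : psi (n%:R * t) = n%:R * psi t.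
  elim: n => [|n IHn]; first by rewrite !mul0r.
  by rewrite -natr1 !mulrDl !mul1r psiD IHn.
have psitau : psi tau = 0 by rewrite /psi /c divfK ?subrr// gt_eqF.
have psiz (z : int) : psi (z%:~R * tau) = 0.
  case: z => n; first by rewrite psiMn psitau mulr0.
  by rewrite NegzE mulrNz mulNr psiN psiMn psitau mulr0 oppr0.
(* psi is tau-periodic, hence bounded above on the whole line. *)
have psiC t : psi t <= C + `|c| * tau.
  pose z := Num.floor (t / tau).
  have /andP[z1 z2] := floor_itv (t / tau).
  rewrite -/z in z1 z2; rewrite intrD in z2.
  have w0 : 0 <= t - z%:~R * tau by rewrite subr_ge0 -ler_pdivlMr.
  have w1 : t - z%:~R * tau < tau.
    by rewrite ltrBlDl; move: z2; rewrite ltr_pdivrMr// mulrDl mul1r.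
  have -> : psi t = psi (t - z%:~R * tau) by rewrite psiD psiN psiz oppr0 addr0.
  set w := t - _ in w0 w1 *.
  apply: lerD; first by apply: phiC; rewrite ger0_norm// (lt_trans w1)// /tau; lra.
  apply: le_trans (ler_norm _) _.
  by rewrite normrN normrM ler_wpM2l// ger0_norm// ltW.
have psi_le0 t : psi t <= 0.
  (* If [psi t > 0], a large enough multiple [n * t] violates the upper bound, since
     [psi (n * t) = n * psi t]. *)
  rewrite leNgt; apply/negP => psit.
  have := psiC ((Num.truncn ((C + `|c| * tau) / psi t)).+1%:R * t).
  by rewrite psiMn -ler_pdivlMr// leNgt -truncn_le_nat leqnn.
move=> t; apply/eqP; rewrite -subr_eq0 -/(psi t) eq_le psi_le0/=.
by have := psi_le0 (- t); rewrite psiN oppr_le0.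
Qed.

Lemma multiplicative_bounded_above_powR K C r : 1 < r ->
  (forall s, 0 < s -> 0 < K s) ->
  (forall s t, 0 < s -> 0 < t -> K (s * t) = K s * K t) ->
  (forall s, r^-1 < s -> s < r -> K s <= C) ->
  exists kappa, forall s, 0 < s -> K s = s `^ kappa.
Proof.
move=> r1 K0 KM KC; have r0 := lt_trans ltr01 r1.
have [||t tr|c Kc] :=
    @additive_bounded_above_linear (fun t => ln (K (expR t))) (ln C) (ln r).
- by rewrite ln_gt0.
- by move=> s t; rewrite expRD KM ?expR_gt0// lnM// posrE K0// expR_gt0.
- move: tr; rewrite ltr_norml => /andP[t1 t2].
  have Kt : K (expR t) <= C.
    by apply: KC; [rewrite -ltr_ln ?posrE ?invr_gt0 ?expR_gt0// lnV ?posrE// expRK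
                  |rewrite -ltr_ln ?posrE ?expR_gt0// expRK].
  have Kt0 := K0 _ (expR_gt0 t).
  by rewrite ler_ln// posrE// (lt_le_trans Kt0).
exists c => s s0; have := Kc (ln s); rewrite lnK ?posrE// => lnKs.
by rewrite /powR gt_eqF// -lnKs lnK// posrE K0.
Qed.

(** Continuity on (0, oo) makes the preimages open there. The Baire property of the limit function
    will come from its closed form. *)
Lemma powR_baire_fun_pos (kappa : R) : baire_fun_pos (fun s => s `^ kappa).
Proof.
move=> V oV; apply: open_baire; rewrite openE => s [/= s0 Vs].
rewrite /interior; apply: filterI.
  by apply: open_nbhs_nbhs; split => //; exact: interval_open.
have : {for s, continuous (fun t => t `^ kappa)}.
  apply/differentiable_continuous/derivable1_diffP/derivable_powR.
  by rewrite inE.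
by apply; exact: open_nbhs_nbhs.
Qed.

End Additive.

(** * Dilations and essential limits of the ratios f(s y) / f(y) *)

Section EssentialRatio.
Context {R : realType}.
Implicit Types (f : R -> R) (p q s t : R) (A B : set R).

(** Both [u] and [s * u] lie in []p, q[] exactly on the interval chosen below, which is nonempty
    because [p / q < s < q / p]. The exceptional points lie in the one for [A] or in its dilate. *)
Lemma dilation_overlap p q s A : 0 < p -> p < q -> (q / p)^-1 < s -> s < q / p ->
  meagre (`]p, q[ `\` A) -> exists p' q', [/\ 0 < p', p' < q' &
    meagre (`]p', q'[ `\` (A `&` ( *%R s) @^-1` A))].
Proof.
move=> p0 pq; have q0 := lt_trans p0 pq.
rewrite invf_div => ps sq mA; have s0 : 0 < s by apply: lt_trans ps; rewrite divr_gt0.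
exists (Num.max p (p / s)), (Num.min q (q / s)); split.
- by rewrite lt_max p0.
- rewrite gt_max !lt_min pq ltr_pdivlMr// mulrC -ltr_pdivlMr// sq/=.
  by rewrite ltr_pdivrMr// mulrC -ltr_pdivrMr// ps ltr_pM2r ?invr_gt0.
apply: meagre_sub (meagreU mA (meagre_scale s0 mA)) => u [/=].
rewrite in_itv/= gt_max lt_min => /andP[/andP[pu psu] /andP[uq usq]] nA.
have [Au|nAu] := pselect (A u); last by left; split => //=; rewrite in_itv/= pu.
right; split => /=; last by move=> Asu; apply: nA.
by rewrite in_itv/= mulrC -ltr_pdivrMr// psu -ltr_pdivlMr.
Qed.

Lemma baire_dilated_le f c1 t1 c2 t2 : baire_fun_pos f -> 0 < t1 -> 0 < t2 ->
  baire_set (`]0, +oo[ `&` [set u | c1 * f (u * t1) <= c2 * f (u * t2)]).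
Proof. by move=> bf t10 t20; apply: baire_le; exact: baire_fun_pos_scale. Qed.

(** Factor the ratio as f(s(ty)) / f(ty) times f(ty) / f(y); the first factor converges because
    dilation by [t] preserves the filter. *)
Lemma ess_ratio_cvgM f s t (K L : R) : (forall y, 0 < y -> 0 < f y) -> 0 < t ->
  f (s * y) / f y @[y --> ess_pinfty] --> K ->
  f (t * y) / f y @[y --> ess_pinfty] --> L ->
  f (s * t * y) / f y @[y --> ess_pinfty] --> K * L.
Proof.
move=> f0 t0 fK fL.
refine (cvg_trans (near_eq_cvg _)
  (cvgM (cvg_comp ( *%R t) _ (ess_pinfty_scale t0) fK) fL)); near=> y.
have y0 : 0 < y by near: y; exact: ess_pinfty_gt.
by rewrite /= -!mulrA mulKf// gt_eqF// f0// mulr_gt0.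
Unshelve. all: by end_near. Qed.

Lemma ess_ratio_cvg1 f : (forall y, 0 < y -> 0 < f y) ->
  f (1 * y) / f y @[y --> ess_pinfty] --> (1 : R).
Proof.
move=> f0; apply: cvg_near_cst; near=> y.
by rewrite mul1r divff// gt_eqF// f0//; near: y; exact: ess_pinfty_gt.
Unshelve. all: by end_near. Qed.

(** Each [s] is a power [w ^+ n] with [w] in []r^-1, r[]: it suffices that [n] exceed
    [|ln s| / ln r]. *)
Lemma ess_ratio_is_cvg_all f r : (forall y, 0 < y -> 0 < f y) -> 1 < r ->
  (forall s, r^-1 < s -> s < r -> cvg (f (s * y) / f y @[y --> ess_pinfty])) ->
  forall s, 0 < s -> cvg (f (s * y) / f y @[y --> ess_pinfty]).
Proof.
move=> f0 r1 near1 s s0; have lnr0 : 0 < ln r by rewrite ln_gt0.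
pose n := (Num.truncn (`|ln s| / ln r)).+1.
have n0 : 0 < n%:R :> R by rewrite ltr0n.
pose w := expR (ln s / n%:R).
have sE : s = w ^+ n by rewrite /w -expRM_natl mulrC divfK ?lnK// gt_eqF.
have : `|ln s / n%:R| < ln r.
  rewrite normrM normfV (gtr0_norm n0) ltr_pdivrMr// mulrC -ltr_pdivrMr//.
  by rewrite -truncn_le_nat.
rewrite ltr_norml -lnV ?posrE ?(lt_trans _ r1)// => /andP[w1 w2].
have r0 := lt_trans ltr01 r1.
have {}w1 : r^-1 < w by rewrite -ltr_ln ?posrE ?invr_gt0 ?expR_gt0// expRK.
have {}w2 : w < r by rewrite -ltr_ln ?posrE ?expR_gt0// expRK.
rewrite sE; elim: {+}n => [|k IHk].
  by rewrite expr0; apply/cvg_ex; exists 1; exact: ess_ratio_cvg1.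
apply/cvg_ex; eexists; rewrite exprS.
apply: ess_ratio_cvgM IHk => //; first by rewrite exprn_gt0// expR_gt0.
exact: near1.
Qed.

End EssentialRatio.

(** * From convergence along the sequence to essential limits and bounds *)

Section RatioLimits.
Context {R : realType}.
Variables (x : nat -> R) (f : R -> R) (a : nat -> R) (g : R -> R) (B : set R).
Hypotheses (x_adm : multiplicatively_admissible x)
  (f_pos : forall y, 0 < y -> 0 < f y) (f_baire : baire_fun_pos f)
  (B_pos : B `<=` `]0, +oo[)
  (a_pos : forall n, 0 < a n)
  (g_pos : forall u, B u -> 0 < g u)
  (f_cvg : forall u, B u -> (fun n => a n * f (u * x n)) @ \oo --> g u).

Let x_pos n : 0 < x n. Proof. by case: x_adm. Qed.

Let B_gt0 u : B u -> 0 < u.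
Proof. by move=> /B_pos; rewrite /= in_itv/= andbT. Qed.

Lemma ratio_cvg s u : B u -> B (s * u) ->
  f (s * (u * x n)) / f (u * x n) @[n --> \oo] --> g (s * u) / g u.
Proof.
move=> Bu Bsu.
refine (cvg_trans (near_eq_cvg _)
  (cvgM (f_cvg Bsu) (cvgV (lt0r_neq0 (g_pos Bu)) (f_cvg Bu)))); near=> n => /=.
by rewrite invfM mulrACA divff ?mul1r ?mulrA// gt_eqF.
Unshelve. all: by end_near. Qed.

(** Countably many sets [E i] cover a non-meagre set, so one of them is non-meagre; having the Baire
    property, it is comeagre in an interval, and [ess_pinfty_cover] spreads its estimate to
    essentially all large [y]. *)
Lemma ess_ratio_is_cvg s : 0 < s -> ~ meagre (B `&` ( *%R s) @^-1` B) ->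
  cvg (f (s * y) / f y @[y --> ess_pinfty]).
Proof.
move=> s0 nmB; apply/cauchy_cvgP/cauchy_exP => e e0.
pose h := e / 3; have h0 : 0 < h by rewrite divr_gt0.
(* On E (N, k) the ratio f(s u x_n) / f(u x_n) is within 2 h of k h from the
   index N on; the ratio is bounded by cross-multiplication, so that only
   pointwise comparison of Baire functions is needed. *)
pose E (i : nat * nat) : set R := \bigcap_n
  ((`]0, +oo[ `&` [set u | (i.2%:R - 1) * h * f (u * x (i.1 + n)%N) <=
                           1 * f (u * (s * x (i.1 + n)%N))]) `&`
   (`]0, +oo[ `&` [set u | 1 * f (u * (s * x (i.1 + n)%N)) <=
                           (i.2%:R + 2) * h * f (u * x (i.1 + n)%N)])).
have bE i : baire_set (E i).
  by apply: baire_bigcap => n; apply: baire_setI;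
    apply: baire_dilated_le => //; rewrite mulr_gt0.
have E0 i : E i `<=` `]0, +oo[ by move=> u /(_ 0%N I) [[]].
have [|[N k] nmE] := nonmeagre_bigcup nmB (E := E).
  move=> u [Bu Bsu]; pose L := g (s * u) / g u.
  have L0 : 0 <= L by rewrite divr_ge0// ltW// g_pos.
  have := ratio_cvg Bu Bsu; rewrite -/L => /cvgrPdist_lt/(_ _ h0)[N _ HN].
  (* Now [k h <= L < (k + 1) h], and the error [h] in the ratio widens this to the bounds
     [(k - 1) h] and [(k + 2) h] of [E]; since [h = e / 3], they stay within [e] of [k h]. *)
  pose k := Num.truncn (L / h); exists (N, k) => // n _.
  have u0 := B_gt0 Bu.
  have k1 : k%:R * h <= L.
    by rewrite -ler_pdivlMr// -truncn_ge_nat// divr_ge0// ltW.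
  have k2 : L < (k%:R + 1) * h.
    by rewrite -ltr_pdivrMr// natr1 -truncn_le_nat.
  have fu0 : 0 < f (u * x (N + n)%N) by rewrite f_pos// mulr_gt0.
  have := HN (N + n)%N (leq_addr _ _).
  rewrite /= ltr_distlC => /andP[r1 r2].
  split; (split; first by rewrite /= in_itv/= u0); rewrite /= mul1r (mulrCA u).
    by rewrite -ler_pdivlMr//; lra.
  by rewrite -ler_pdivrMr//; lra.
have [p [q [p0 pq mE]]] := baire_nonmeagre_itv (E0 _) (bE _) nmE.
exists (k%:R * h).
apply: (ess_pinfty_cover (N := N) x_adm p0 pq mE) => u n Eu Nn.
have [[/=]] := Eu (n - N)%N I.
rewrite in_itv/= subnKC// andbT !mul1r (mulrCA u) => u0 r1 [_ r2].
have fu0 : 0 < f (u * x n) by rewrite f_pos// mulr_gt0.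
rewrite /ball/= ltr_distlC.
rewrite -ler_pdivlMr// in r1; rewrite -ler_pdivrMr// in r2.
by apply/andP; split; rewrite /h in r1 r2 *; lra.
Qed.

(** On [E N] the values [a n * f (u * x n)] lie between [1 / (N + 1)] and [N + 1] from index [N] on.
    Positivity of [g] makes these sets cover [B]. Where [u] and [s * u] are both in one [E N], the
    ratio is at most [(N + 1) ^ 2]. *)
Lemma ess_ratio_bounded : baire_set B -> ~ meagre B -> exists (C r : R),
  1 < r /\ forall s, r^-1 < s -> s < r ->
    \forall y \near ess_pinfty, f (s * y) / f y <= C.
Proof.
move=> bB nmB.
pose E (N : nat) : set R := \bigcap_n
  ((`]0, +oo[ `&` [set u | N.+1%:R^-1 <= a (N + n)%N * f (u * x (N + n)%N)]) `&`
   (`]0, +oo[ `&` [set u | a (N + n)%N * f (u * x (N + n)%N) <= N.+1%:R])).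
have bE i : baire_set (E i).
  by apply: baire_bigcap => n; apply: baire_setI;
    apply: baire_le; [exact: baire_fun_pos_cst|exact: baire_fun_pos_scale..|exact: baire_fun_pos_cst].
have E0 i : E i `<=` `]0, +oo[ by move=> u /(_ 0%N I) [[]].
have [|N nmE] := nonmeagre_bigcup nmB (E := E).
  move=> u Bu; have gu0 := g_pos Bu.
  have /(cvgr_ge _ (f_cvg Bu))[N1 _ HN1] : g u / 2 < g u by lra.
  have /(cvgr_le _ (f_cvg Bu))[N2 _ HN2] : g u < g u + 1 by lra.
  (* A single [N] serves as starting index and as bound, so it dominates both thresholds and both
     limit estimates. *)
  pose N := maxn (maxn N1 N2) (maxn (Num.truncn (g u / 2)^-1) (Num.truncn (g u + 1))).
  exists N => // n _.
  have u0 := B_gt0 Bu.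
  have k1 : (g u / 2)^-1 <= N.+1%:R.
    by apply/ltW; rewrite -truncn_le_nat !leq_max leqnn !orbT.
  have k2 : g u + 1 <= N.+1%:R.
    by apply/ltW; rewrite -truncn_le_nat !leq_max leqnn !orbT.
  have NN1 : (N1 <= N + n)%N by apply: leq_trans (leq_addr _ _); rewrite !leq_max leqnn.
  have NN2 : (N2 <= N + n)%N by apply: leq_trans (leq_addr _ _); rewrite !leq_max leqnn !orbT.
  split; (split; first by rewrite /= in_itv/= u0).
    apply: le_trans (HN1 _ NN1).
    by rewrite -[leRHS]invrK lef_pV2// posrE// invr_gt0 divr_gt0.
  exact: le_trans (HN2 _ NN2) k2.
have [p [q [p0 pq mE]]] := baire_nonmeagre_itv (E0 _) (bE _) nmE.
exists (N.+1%:R * N.+1%:R), (q / p); split; first by rewrite ltr_pdivlMr// mul1r.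
move=> s ps sq.
have [p' [q' [p'0 pq' mE']]] := dilation_overlap p0 pq ps sq mE.
apply: (ess_pinfty_cover (N := N) x_adm p'0 pq' mE') => u n [Eu Esu] Nn.
have [[/=]] := Eu (n - N)%N I.
rewrite in_itv/= subnKC// andbT => u0 r1 _.
have [_ [_ /=]] := Esu (n - N)%N I.
rewrite subnKC// -mulrA => r2.
have fu0 : 0 < f (u * x n) by rewrite f_pos// mulr_gt0.
rewrite ler_pdivrMr// -(ler_pM2l (a_pos n)); apply: le_trans r2 _.
rewrite mulrCA -mulrA ler_peMr//.
by rewrite -ler_pdivrMl// mulr1.
Qed.

End RatioLimits.

(** * Existence, multiplicativity and power form of the limit function *)

Theorem theorem1 (R : realType) (x : nat -> R) (f : R -> R) (B : set R)
    (a : nat -> R) (g : R -> R)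
    (x_adm : multiplicatively_admissible x)
    (f_pos : forall y, 0 < y -> 0 < f y)
    (f_baire : baire_fun_pos f)
    (B_pos : B `<=` `]0, +oo[)
    (B_nonmeagre : ~ meagre B)
    (B_baire : baire_set B)
    (a_pos : forall n, 0 < a n)
    (g_pos : forall lam, B lam -> 0 < g lam)
    (f_cvg : forall lam, B lam ->
       (fun n => a n * f (lam * x n)) @ \oo --> g lam) :
  strongly_quasi_regularly_varying f /\
  exists K : R -> R,
    [/\ is_ess_ratio_lim f K,
        forall s t : R, 0 < s -> 0 < t -> K (s * t) = K s * K t,
        bounded_near K (nbhs (1 : R))
      & exists kappa : R, forall s : R, 0 < s -> K s = s `^ kappa].
Proof.
have [p [q [p0 pq mB]]] := baire_nonmeagre_itv B_pos B_baire B_nonmeagre.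
have r1 : 1 < q / p by rewrite ltr_pdivlMr// mul1r.
have ratio_is_cvg : forall s, 0 < s -> cvg (f (s * y) / f y @[y --> ess_pinfty]).
  apply: (ess_ratio_is_cvg_all f_pos r1) => s rs sr.
  have s0 : 0 < s by apply: lt_trans rs; rewrite invr_gt0 (lt_trans _ r1).
  apply: (ess_ratio_is_cvg x_adm f_pos f_baire B_pos a_pos g_pos f_cvg) => // mBs.
  (* Were the overlap of [B] with its dilate meagre, the whole interval []p', q'[] would be
     meagre. *)
  have [p' [q' [_ pq' mB']]] := dilation_overlap p0 pq rs sr mB.
  apply: (itv_nonmeagre pq'); apply: meagre_sub (meagreU mB' mBs) => u pqu.
  by have [|] := pselect ((B `&` ( *%R s) @^-1` B) u); [right|left].
pose K s : R := lim (f (s * y) / f y @[y --> ess_pinfty]).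
have fK s : 0 < s -> f (s * y) / f y @[y --> ess_pinfty] --> K s.
  exact: ratio_is_cvg.
have KM s t : 0 < s -> 0 < t -> K (s * t) = K s * K t.
  move=> s0 t0; apply: (cvg_unique (@Rhausdorff R)) (fK _ (mulr_gt0 s0 t0)) _.
  by apply: ess_ratio_cvgM => //; exact: fK.
have K1 : K 1 = 1.
  by apply: (cvg_unique (@Rhausdorff R)) (fK _ ltr01) (ess_ratio_cvg1 f_pos).
have K_ge0 s : 0 < s -> 0 <= K s.
  move=> s0; apply: cvgr_to_ge (fK _ s0) _; near=> y.
  have y0 : 0 < y by near: y; exact: ess_pinfty_gt.
  by rewrite divr_ge0// ltW// f_pos// mulr_gt0.
have K_gt0 s : 0 < s -> 0 < K s.
  (* Passing to the limit only gives [K s >= 0]; a zero is excluded by [K s * K s^-1 = K 1 = 1]. *)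
  move=> s0; rewrite lt_neqAle K_ge0// andbT; apply/eqP => K0.
  have sV0 : 0 < s^-1 by rewrite invr_gt0.
  have := KM _ _ s0 sV0; rewrite divff ?gt_eqF// K1 -K0 mul0r => K10.
  by have := oner_neq0 R; rewrite [X in X != _]K10 eqxx.
have [C [r [r_gt1 fC]]] :=
  ess_ratio_bounded x_adm f_pos f_baire B_pos a_pos g_pos f_cvg B_baire B_nonmeagre.
have rV0 : 0 < r^-1 by rewrite invr_gt0 (lt_trans _ r_gt1).
have KC s : r^-1 < s -> s < r -> K s <= C.
  by move=> rs sr; apply: cvgr_to_le (fK _ (lt_trans rV0 rs)) (fC _ rs sr).
have [kappa Kkappa] := multiplicative_bounded_above_powR r_gt1 K_gt0 KM KC.
have limK : is_ess_ratio_lim f K by move=> s s0; apply/is_ess_limP/fK.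
split.
  (* The power function agrees with [K] on (0, oo), so it is a valid ratio limit already known to be
     Baire. *)
  split => //; exists (fun s => s `^ kappa); split; last exact: powR_baire_fun_pos.
  by move=> s s0; rewrite -Kkappa//; exact: limK.
exists K; split => //; last by exists kappa.
rewrite /bounded_near; near=> M.
have near1 : nbhs (1 : R) `]r^-1, r[%classic.
  apply: open_nbhs_nbhs; split; first exact: interval_open.
  by rewrite /= in_itv/= r_gt1 andbT invf_lt1// (lt_trans _ r_gt1).
apply: filterS near1 => s /=; rewrite in_itv/= => /andP[rs sr].
rewrite ger0_norm; last exact: K_ge0 (lt_trans rV0 rs).
by apply: le_trans (KC _ rs sr) _; near: M; apply: nbhs_pinfty_ge; exact: num_real.
Unshelve. all: by end_near. Qed.
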